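(* Let $\mathcal{F}:\mathcal{M}\to\Omega$ be a Fitting invariant. Then for any $n\ge0$, the following map $\mathcal{F}^{[n]}:\mathcal{M}\to\Omega$ is well-defined: for each $M\in\mathcal{M}$, take an exact sequence \[ 0\to N\to P_1\to\dots\to P_n\to M\to0 \] in $\mathcal{M}$ with $P_1,\dots,P_n\in\mathcal{P}$ and define \[ \mathcal{F}^{[n]}(M)=\left(\prod_{i=1}^n\mathcal{F}(P_i)^{(-1)^i}\right)\mathcal{F}(N). \] Moreover, $\mathcal{F}^{[n]}:\mathcal{M}\to\Omega$ is again a Fitting invariant.
   Context: $R$ is a (not necessarily commutative) ring with unity which is left and right noetherian, and $S$ is an Ore set of $R$ consisting of non-zero-divisors: $1\in S$; $S$ is closed under multiplication; and for $f\in S$, $a\in R$ one has $fR\cap aS\ne\emptyset$ and $Rf\cap Sa\ne\emptyset$. A left $R$-module is $S$-torsion if each of its elements is annihilated by an element of $S$. $\mathcal M$ is the category of finitely generated $S$-torsion left $R$-modules and $\mathcal P=\{P\in\mathcal M\mid\mathrm{pd}_R(P)\le1\}$, with $\mathrm{pd}_R$ the projective dimension (the zero module has $\mathrm{pd}_R=-\infty$). A Fitting invariant is a map $\mathcal F$ assigning to each object of $\mathcal M$ an element of a commutative monoid $\Omega$ such that: (i) $\mathcal F(P)\in\Omega^\times$ for $P\in\mathcal P$; (ii) if $0\to M'\to M\to P\to0$ is exact in $\mathcal M$ with $P\in\mathcal P$, then $\mathcal F(M)=\mathcal F(P)\mathcal F(M')$. ''Well-defined'' means that such an exact sequence exists for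 each $M$ and that the value does not depend on its choice. *)

(* Defs.v *)
From Stdlib Require Import ClassicalEpsilon.
From HB Require Import structures.
From mathcomp Require Import all_boot all_algebra.

Set Implicit Arguments.
Unset Strict Implicit.
Unset Printing Implicit Defensive.

Import GRing.Theory.
Local Open Scope ring_scope.

(* [pzRingType] does not assume 1 <> 0: the zero ring is allowed. *)

Definition noetherian (R : pzRingType) (V : lmodType R) : Prop :=
  forall I : nat -> {pred V},
    (forall n, submod_closed (I n)) ->
    (forall n, {subset I n <= I n.+1}) ->
    exists N, forall n, (N <= n)%N -> I n =i I N.

Definition left_noetherian (R : pzRingType) : Prop := @noetherian R R^o.

(* Right ideals of R are left ideals of the converse ring. *)
Definition right_noetherian (R : pzRingType) : Prop := @noetherian R^c (R^c)^o.

Definition regular_ore_set (R : pzRingType) (S : {pred R}) : Prop :=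
  [/\ mulr_closed S,
      forall f, f \in S -> GRing.lreg f /\ GRing.rreg f,
      forall f a, f \in S -> exists r s, s \in S /\ f * r = a * s
    & forall f a, f \in S -> exists r s, s \in S /\ r * f = s * a].

Section Modules.

Variable R : pzRingType.

Definition surjective (A B : Type) (f : A -> B) : Prop :=
  forall b, exists a, f a = b.

Definition finitely_generated (M : lmodType R) : Prop :=
  exists (r : nat) (g : 'I_r -> M),
    forall m, exists c : 'I_r -> R, m = \sum_(i < r) c i *: g i.

Definition torsion (S : {pred R}) (M : lmodType R) : Prop :=
  forall m : M, exists2 s, s \in S & s *: m = 0.

Definition projective (P : lmodType R) : Prop :=
  forall (A B : lmodType R) (g : {linear A -> B}) (f : {linear P -> B}),
    surjective g -> exists h : {linear P -> A}, forall x, g (h x) = f x.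

Definition short_exact (M' M M'' : lmodType R)
    (f : {linear M' -> M}) (g : {linear M -> M''}) : Prop :=
  [/\ injective f, surjective g & forall x, g x = 0 <-> exists y, f y = x].

Definition target (M : lmodType R) (C : nat -> lmodType R) (i : nat) :
    lmodType R :=
  if i is j.+1 then C j else M.

(* An exact sequence 0 -> C n -> ... -> C 0 -> M -> 0; the map diff i goes out of
   C i, and the terms C i with n < i play no role. *)
Record exact_sequence (n : nat) (M : lmodType R) (C : nat -> lmodType R) :=
  ExactSequence {
    diff : forall i, {linear C i -> target M C i};
    diff_inj : injective (diff n);
    diff_exact : forall i, (i < n)%N ->
      forall x : C i, diff i x = 0 <-> exists y : C i.+1, diff i.+1 y = x;
    diff_surj : surjective (diff 0%N) }.

(* pd M <= n: there is a projective resolution of length n (padding by zeros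
   makes "length n" and "length at most n" the same). *)
Definition proj_dim_le (M : lmodType R) (n : nat) : Prop :=
  exists C : nat -> lmodType R,
    (forall i, (i <= n)%N -> projective (C i)) /\
    inhabited (exact_sequence n M C).

Record fgtors (S : {pred R}) := FGTors {
  fgtors_mod :> lmodType R;
  fgtors_fg : finitely_generated fgtors_mod;
  fgtors_tors : torsion S fgtors_mod }.

Definition in_P (S : {pred R}) (P : fgtors S) : Prop := proj_dim_le P 1.

(* An exact sequence 0 -> N -> P_1 -> ... -> P_n -> M -> 0 of objects of the
   category, with all P_i in in_P.  The terms are numbered from M leftwards, so
   that P_i = X (n - i) and N = X n; X i is irrelevant for n < i. *)
Record left_resolution (S : {pred R}) (n : nat) (M : fgtors S) :=
  LeftResolution {
    lr_term :> nat -> fgtors S;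
    lr_seq : exact_sequence n M (fun i => lr_term i);
    lr_P : forall i, (i < n)%N -> in_P (lr_term i) }.

Definition lr_Pterm S n (M : fgtors S) (X : left_resolution n M) (i : nat) :=
  X (n - i)%N.

Definition lr_Nterm S n (M : fgtors S) (X : left_resolution n M) := X n.

End Modules.

Section FittingInvariants.

Variables (R : pzRingType) (S : {pred R}).
Variables (Omega : Type) (one : Omega) (mul : Monoid.com_law one).

Definition is_unit (x : Omega) : Prop := exists y, mul x y = one.

(* The inverse of x if x is a unit, and an arbitrary element otherwise. *)
Definition inv (x : Omega) : Omega :=
  epsilon (inhabits one) (fun y => mul x y = one).

(* x ^ ((-1) ^ i) *)
Definition pow_sign (x : Omega) (i : nat) : Omega :=
  if odd i then inv x else x.

Definition fitting_invariant (F : fgtors S -> Omega) : Prop :=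
  (forall P, in_P P -> is_unit (F P)) /\
  (forall (M' M P : fgtors S) (f : {linear M' -> M}) (g : {linear M -> P}),
     in_P P -> short_exact f g -> F M = mul (F P) (F M')).

Definition resolution_value (F : fgtors S -> Omega) n (M : fgtors S)
    (X : left_resolution n M) : Omega :=
  mul (\big[mul/one]_(1 <= i < n.+1) pow_sign (F (lr_Pterm X i)) i)
      (F (lr_Nterm X)).

End FittingInvariants.

(* Main.v *)
(* On a module P of projective dimension at most 1, F^[1] takes the value F(P)^-1,
   so F^[n+1] = (F^[n])^[1] and only n = 1 needs an argument.  Two presentations
   0 -> N -> P -> M -> 0 and 0 -> N' -> P' -> M -> 0 are compared through the
   pullback X of P and P' over M: F(X) = F(P') F(N) = F(P) F(N').  For
   0 -> L -> M -> P -> 0 and a presentation 0 -> N -> Q -> M -> 0, the kernel K of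
   Q -> P has projective dimension at most 1 by Schanuel's lemma and gives a
   presentation 0 -> N -> K -> L -> 0, whence F(Q) = F(P) F(K) yields (ii). *)

Require Import Defs.
From Stdlib Require Import ClassicalEpsilon.
From HB Require Import structures.
From mathcomp Require Import all_boot all_algebra.

Set Implicit Arguments.
Unset Strict Implicit.
Unset Printing Implicit Defensive.

Import GRing.Theory Monoid.Theory.
Import Defs.
Local Open Scope ring_scope.
Local Open Scope quotient_scope.

(** * Boolean predicates from propositions, and sections by choice *)

Definition classical_pred (T : Type) (P : T -> Prop) : {pred T} :=
  fun x => if excluded_middle_informative (P x) then true else false.

Lemma classical_predP (T : Type) (P : T -> Prop) (x : T) :
  reflect (P x) (x \in classical_pred P).
Proof.
by rewrite unfold_in; case: excluded_middle_informative => ?; constructor.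
Qed.

Lemma surjective_section (A B : Type) (f : A -> B) :
  surjective f -> exists g : B -> A, cancel g f.
Proof.
move=> f_surj.
pose pick b := constructive_indefinite_description _ (f_surj b).
by exists (fun b => sval (pick b)) => b; apply: (svalP (pick b)).
Qed.

(** * Linear maps, submodules and quotient modules *)

Section LinearMaps.

Variable R : pzRingType.
Implicit Types U V W : lmodType R.

Lemma linear_bundle U V (f : U -> V) :
  linear f -> exists g : {linear U -> V}, forall x, g x = f x.
Proof.
move=> f_lin.
pose fM := GRing.isLinear.Build R U V *:%R f f_lin.
pose g : {linear U -> V} := HB.pack f fM.
by exists g.
Qed.

(** Preimages under [i] are chosen pointwise; injectivity of [i] makes the choice unique, hence
    linear. *)
Lemma linear_factor U V W (i : {linear W -> V}) (f : {linear U -> V}) :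
  injective i -> (forall x, exists w, i w = f x) ->
  exists g : {linear U -> W}, forall x, i (g x) = f x.
Proof.
move=> i_inj f_im.
pose pick x := constructive_indefinite_description _ (f_im x).
have pickP x : i (sval (pick x)) = f x := svalP (pick x).
have [|g gE] := @linear_bundle U W (fun x => sval (pick x)).
  by move=> a x y; apply: i_inj; rewrite [RHS]linearP /= !pickP linearP.
by exists g => x; rewrite gE.
Qed.

Section SubModule.

Variables (V : lmodType R) (U : {pred V}) (U_closed : submod_closed U).

(** The closure proof is a phantom argument: it gives the instance below a head symbol to attach to,
    for arbitrary [U]. *)
Definition closed_pred (_ : submod_closed U) : {pred V} := U.

HB.instance Definition _ :=
  GRing.isSubmodClosed.Build R V (closed_pred U_closed) U_closed.

Record submodule := Submodule {
  submodule_val : V; submodule_valP : submodule_val \in closed_pred U_closed }.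

HB.instance Definition _ := [isSub for submodule_val].
HB.instance Definition _ := [Choice of submodule by <:].
HB.instance Definition _ := [SubChoice_isSubLmodule of submodule by <:].

(** The quotient is first formed as an additive group; scaling is then defined through
    representatives. *)
Definition quotient_module : Type :=
  Quotient.quot (closed_pred U_closed : zmodClosed V).

HB.instance Definition _ := GRing.Zmodule.on quotient_module.
HB.instance Definition _ := Quotient.on quotient_module.

Definition quotient_scale (a : R) (x : quotient_module) : quotient_module :=
  \pi_(quotient_module) (a *: repr x).

Lemma quotient_scale_pi a (x : V) :
  quotient_scale a (\pi_(quotient_module) x) = \pi_(quotient_module) (a *: x).
Proof.
apply/eqP; rewrite /quotient_scale -Quotient.idealrBE -scalerBr.
apply: (@rpredZ R V (closed_pred U_closed)).
by rewrite Quotient.idealrBE reprK.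
Qed.

Lemma quotient_scaleA a b (x : quotient_module) :
  quotient_scale a (quotient_scale b x) = quotient_scale (a * b) x.
Proof.
by elim/quotW: x => x; rewrite (quotient_scale_pi b) !quotient_scale_pi scalerA.
Qed.

Lemma quotient_scale1 : left_id 1 quotient_scale.
Proof. by elim/quotW=> x; rewrite quotient_scale_pi scale1r. Qed.

Lemma quotient_scaleDr : right_distributive quotient_scale +%R.
Proof.
move=> a; elim/quotW=> x; elim/quotW=> y.
by rewrite -raddfD !quotient_scale_pi scalerDr raddfD.
Qed.

Lemma quotient_scaleDl (x : quotient_module) :
  {morph quotient_scale^~ x : a b / a + b}.
Proof.
by move=> a b; elim/quotW: x => x; rewrite !quotient_scale_pi scalerDl raddfD.
Qed.

HB.instance Definition _ := GRing.Zmodule_isLmodule.Build R quotient_module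
  quotient_scaleA quotient_scale1 quotient_scaleDr quotient_scaleDl.

End SubModule.

Lemma submodule_exists V (U : {pred V}) : submod_closed U ->
  exists (W : lmodType R) (i : {linear W -> V}),
    injective i /\ forall x, x \in U <-> exists w, i w = x.
Proof.
move=> U_closed.
exists (submodule U_closed), (\val : {linear submodule U_closed -> V}).
split=> [|x]; first exact: val_inj.
split=> [xU|[w <-]]; last exact: submodule_valP.
by exists (@Submodule _ _ U_closed x xU).
Qed.

Lemma quotient_exists V (U : {pred V}) : submod_closed U ->
  exists (W : lmodType R) (p : {linear V -> W}),
    surjective p /\ forall x, p x = 0 <-> x \in U.
Proof.
move=> U_closed; have [|p pE] := @linear_bundle V (quotient_module U_closed)
  (\pi_(quotient_module U_closed)).
  by move=> a x y; rewrite raddfD /= -quotient_scale_pi.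
exists (quotient_module U_closed), p; split=> [y|x].
  by exists (repr y); rewrite pE reprK.
rewrite pE -(raddf0 (\pi_(quotient_module U_closed))).
have -> : (x \in U) = (x - 0 \in closed_pred U_closed) by rewrite subr0.
by rewrite (Quotient.idealrBE (closed_pred U_closed)); split=> [->|/eqP].
Qed.

Lemma kernel_exists U V (f : {linear U -> V}) :
  exists (K : lmodType R) (k : {linear K -> U}),
    injective k /\ forall x, f x = 0 <-> exists y, k y = x.
Proof.
have [|K [k [k_inj kP]]] := @submodule_exists U (fun x => f x == 0).
  split=> [|a x y]; rewrite !unfold_in ?linear0 // linearP.
  by move=> /eqP-> /eqP->; rewrite scaler0 addr0.
by exists K, k; split=> // x; rewrite -kP; split=> /eqP.
Qed.

Lemma image_exists U V (f : {linear U -> V}) :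
  exists (I : lmodType R) (i : {linear I -> V}) (e : {linear U -> I}),
    [/\ injective i, surjective e & forall x, i (e x) = f x].
Proof.
have [|I [i [i_inj iP]]] :=
    @submodule_exists V (classical_pred (fun y => exists x, f x = y)).
  split=> [|a y z]; first by apply/classical_predP; exists 0; rewrite linear0.
  move=> /classical_predP[u <-] /classical_predP[v <-].
  by apply/classical_predP; exists (a *: u + v); rewrite linearP.
have [|e eP] := linear_factor (f := f) i_inj.
  by move=> x; apply/iP/classical_predP; exists x.
exists I, i, e; split=> // y.
have /classical_predP[x fx] : i y \in classical_pred (fun y => exists x, f x = y).
  by apply/iP; exists y.
by exists x; apply: i_inj; rewrite eP.
Qed.

End LinearMaps.

(** * Pullbacks, short exact sequences and projective dimension at most 1 *)

Section Exactness.

Variable R : pzRingType.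
Implicit Types A B C N U X : lmodType R.

(** Elementwise form of the universal property: [(p, q)] identifies [X] with the pairs in [A * B]
    that agree in [C]. *)
Definition is_pullback A B C X (f : {linear A -> C}) (g : {linear B -> C})
    (p : {linear X -> A}) (q : {linear X -> B}) : Prop :=
  [/\ forall x, f (p x) = g (q x),
      forall a b, f a = g b -> exists x, p x = a /\ q x = b
    & forall x, p x = 0 -> q x = 0 -> x = 0].

Lemma is_pullback_sym A B C X (f : {linear A -> C}) (g : {linear B -> C})
    (p : {linear X -> A}) (q : {linear X -> B}) :
  is_pullback f g p q -> is_pullback g f q p.
Proof.
case=> fpgq pq_onto pq_inj; split=> [x|b a /esym/pq_onto[x []]|x qx px].
- by rewrite fpgq.
- by exists x.
- exact: pq_inj.
Qed.

Lemma pullback_exists A B C (f : {linear A -> C}) (g : {linear B -> C}) :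
  exists (X : lmodType R) (p : {linear X -> A}) (q : {linear X -> B}),
    is_pullback f g p q.
Proof.
have [|X [i [i_inj iP]]] := @submodule_exists R (A * B)%type
    (fun u => f u.1 == g u.2).
  split=> [|a u v]; rewrite !unfold_in /= ?linear0 // !linearP.
  by move=> /eqP-> /eqP->.
exists X, (fst \o i : {linear X -> A}), (snd \o i : {linear X -> B}).
split=> /= [x|a b fagb|x px qx].
- by apply/eqP/iP; exists x.
- have /iP[x ix] : (a, b) \in (fun u : A * B => f u.1 == g u.2).
    exact/eqP.
  by exists x; rewrite ix.
- apply: i_inj; rewrite linear0.
  by case: (i x) px qx => u v /= -> ->.
Qed.

(** [X] embeds into [A * B] by [(p, q)], and [(u, v)] takes its values in the image, so it
    factors. *)
Lemma pullback_lift A B C X (f : {linear A -> C}) (g : {linear B -> C})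
    (p : {linear X -> A}) (q : {linear X -> B}) U
    (u : {linear U -> A}) (v : {linear U -> B}) :
  is_pullback f g p q -> (forall x, f (u x) = g (v x)) ->
  exists w : {linear U -> X}, forall x, p (w x) = u x /\ q (w x) = v x.
Proof.
case=> fpgq pq_onto pq_inj fugv.
have [|i iE] := @linear_bundle R X (A * B)%type (fun x => (p x, q x)).
  by move=> a x y; rewrite !linearP.
have [|j jE] := @linear_bundle R U (A * B)%type (fun x => (u x, v x)).
  by move=> a x y; rewrite !linearP.
have [||w wE] := @linear_factor _ _ _ _ i j.
- apply: raddf_inj => x /=; rewrite iE => -[px qx].
  exact: pq_inj.
- move=> x; have [y [py qy]] := pq_onto _ _ (fugv x).
  by exists y; rewrite iE jE py qy.
by exists w => x; move: (wE x); rewrite iE jE => -[].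
Qed.

Lemma short_exact_comp0 A B C (f : {linear A -> B}) (g : {linear B -> C}) x :
  short_exact f g -> g (f x) = 0.
Proof. by case=> _ _ fgP; apply/fgP; exists x. Qed.

Lemma short_exact_kernel B C (g : {linear B -> C}) : surjective g ->
  exists (A : lmodType R) (f : {linear A -> B}), short_exact f g.
Proof. by move=> g_surj; have [A [f []]] := kernel_exists g; exists A, f. Qed.

(** Base change preserves the kernel: [m] is the lift of the pair [(0, n)]. *)
Lemma pullback_short_exact A B C X N (f : {linear A -> C}) (g : {linear B -> C})
    (p : {linear X -> A}) (q : {linear X -> B}) (n : {linear N -> B}) :
  is_pullback f g p q -> short_exact n g ->
  exists m : {linear N -> X}, short_exact m p.
Proof.
move=> pb n_g; have [n_inj g_surj ngP] := n_g; have [fpgq pq_onto pq_inj] := pb.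
have [|m mE] := pullback_lift (u := \0 : {linear N -> A}) (v := n) pb.
  by move=> x /=; rewrite linear0 (short_exact_comp0 _ n_g).
exists m; split=> [|a|x].
- apply: raddf_inj => x mx0; apply: n_inj.
  by have [_ <-] := mE x; rewrite mx0 !linear0.
- have [b gb] := g_surj (f a).
  by have [x [px _]] := pq_onto a b (esym gb); exists x.
split=> [px0|[y <-]]; last by have [] := mE y.
have /ngP[y ny] : g (q x) = 0 by rewrite -fpgq px0 linear0.
exists y; apply/eqP; rewrite -subr_eq0; apply/eqP.
by have [pm qm] := mE y; apply: pq_inj; rewrite raddfB /= ?pm ?qm ?px0 ?ny subrr.
Qed.

(** [s] lifts the identity of [C]; then [b - s (g b)] lies in the kernel of [g], and [r] is its
    preimage under [f]. *)
Lemma short_exact_split A B C (f : {linear A -> B}) (g : {linear B -> C}) :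
  short_exact f g -> projective C ->
  exists (r : {linear B -> A}) (s : {linear C -> B}),
    (forall c, g (s c) = c) /\ (forall b, f (r b) = b - s (g b)).
Proof.
case=> f_inj g_surj fgP C_proj.
have [s sE] := C_proj _ _ g (idfun : {linear C -> C}) g_surj.
have [|d dE] := @linear_bundle R B B (fun b => b - s (g b)).
  by move=> a x y; rewrite !linearP /= scalerDr addrACA.
have [|r rE] := linear_factor (f := d) f_inj.
  by move=> x; apply/fgP; rewrite dE linearB /= sE subrr.
by exists r, s; split=> [c|b]; rewrite ?sE // rE dE.
Qed.

(** The sequence splits, so lifts on [A] and on [C] add up to a lift on [B]. *)
Lemma projective_extension A B C (f : {linear A -> B}) (g : {linear B -> C}) :
  short_exact f g -> projective A -> projective C -> projective B.
Proof.
move=> f_g A_proj C_proj Y Z h k h_surj.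
have [r [s [gs fr]]] := short_exact_split f_g C_proj.
have [a aE] := A_proj _ _ h (k \o f : {linear A -> Z}) h_surj.
have [c cE] := C_proj _ _ h (k \o s : {linear C -> Z}) h_surj.
have [|l lE] := @linear_bundle R B Y (fun b => a (r b) + c (g b)).
  by move=> x u v; rewrite !linearP /= scalerDr addrACA.
by exists l => b; rewrite lE linearD aE cE /= fr linearB subrK.
Qed.

(** The splitting [r] is a retraction of [f], so [A] is a direct summand of [B]. *)
Lemma projective_kernel A B C (f : {linear A -> B}) (g : {linear B -> C}) :
  short_exact f g -> projective B -> projective C -> projective A.
Proof.
move=> f_g B_proj C_proj Y Z h k h_surj.
have [r [s [gs fr]]] := short_exact_split f_g C_proj.
have [b bE] := B_proj _ _ h (k \o r : {linear B -> Z}) h_surj.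
exists (b \o f : {linear A -> Y}) => x /=; rewrite bE /=; congr (k _).
have [f_inj _ _] := f_g; apply: f_inj.
by rewrite fr (short_exact_comp0 _ f_g) linear0 subr0.
Qed.

Lemma projective_free n : projective 'rV[R]_n.
Proof.
move=> A B g f g_surj; have [s sK] := surjective_section g_surj.
have [|h hE] := @linear_bundle R 'rV[R]_n A
    (fun v => \sum_i v 0 i *: s (f (delta_mx 0 i))).
  move=> a u v; rewrite scaler_sumr -big_split; apply: eq_bigr => i _ /=.
  by rewrite !mxE scalerDl scalerA.
exists h => v; rewrite hE {2}[v]row_sum_delta !linear_sum.
by apply: eq_bigr => i _; rewrite !linearZ /= sK.
Qed.

Lemma proj_dim_le1P (M : lmodType R) :
  proj_dim_le M 1 <->
  exists A B (f : {linear A -> B}) (g : {linear B -> M}),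
    [/\ projective A, projective B & short_exact f g].
Proof.
split=> [[C [C_proj [[d d_inj d_exact d_surj]]]]|].
  exists (C 1%N), (C 0%N), (d 1%N), (d 0%N); split; [exact: C_proj..|].
  by split=> //; apply: d_exact.
case=> A [B [f [g [A_proj B_proj [f_inj g_surj fgP]]]]].
pose C i := if i is 0%N then B else A.
exists C; split; first by case=> [|[]].
(* The maps with [i >= 2] are placeholders: exactness is tested only at [i = 0], injectivity at
   [i = 1]. *)
pose d i : {linear C i -> target M C i} :=
  match i with 0%N => g | 1%N => f | j.+2 => (idfun : {linear A -> A}) end.
by constructor; exists d => // -[].
Qed.

(** Let [K] be the kernel of the composite [B0 -> B -> C]. It is projective, it maps onto [A]
    through [b0], and the kernel of that map is [B1]; so [0 -> B1 -> K -> A -> 0] is the required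
    resolution. *)
Lemma proj_dim_le1_kernel A B C (f : {linear A -> B}) (g : {linear B -> C}) :
  short_exact f g -> proj_dim_le B 1 -> proj_dim_le C 1 -> proj_dim_le A 1.
Proof.
move=> f_g /proj_dim_le1P[B1 [B0 [b1 [b0 [B1_proj B0_proj b1_b0]]]]].
move=> /proj_dim_le1P[C1 [C0 [c1 [c0 [C1_proj C0_proj c1_c0]]]]].
have [f_inj g_surj fgP] := f_g; have [b1_inj b0_surj b1b0P] := b1_b0.
pose gb0 : {linear B0 -> C} := g \o b0.
have gb0_surj : surjective gb0.
  by move=> c; have [b <-] := g_surj c; have [x <-] := b0_surj b; exists x.
have [K [k k_gb0]] := short_exact_kernel gb0_surj.
(* Schanuel: the pullback of gb0 and c0 is an extension of B0 by C1, and of C0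
   by K. *)
have K_proj : projective K.
  have [X [p [q pb]]] := pullback_exists gb0 c0.
  have [m m_p] := pullback_short_exact pb c1_c0.
  have [m' m'_q] := pullback_short_exact (is_pullback_sym pb) k_gb0.
  apply: projective_kernel m'_q _ C0_proj.
  exact: projective_extension m_p C1_proj B0_proj.
have [k_inj _ kP] := k_gb0.
have [|e eE] := linear_factor (f := b0 \o k : {linear K -> B}) f_inj.
  by move=> x; apply/fgP/(short_exact_comp0 _ k_gb0).
have [|i iE] := linear_factor (f := b1) k_inj.
  by move=> x; apply/kP; rewrite /= (short_exact_comp0 _ b1_b0) linear0.
apply/proj_dim_le1P; exists B1, K, i, e; split=> //; split=> [x y ixy|a|x].
- by apply: b1_inj; rewrite -!iE ixy.
- have [b bE] := b0_surj (f a).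
  have /kP[x kx] : gb0 b = 0 by rewrite /= bE (short_exact_comp0 _ f_g).
  by exists x; apply: f_inj; rewrite eE /= kx.
(* As [f] is injective, the kernel of [e] is the part of [K] killed by [b0], that is, the image of
   [B1]. *)
- have -> : e x = 0 <-> b0 (k x) = 0.
    split=> [ex0|b0kx]; first by rewrite -[LHS]eE ex0 linear0.
    by apply: f_inj; rewrite eE linear0.
  rewrite b1b0P; split=> -[y yE]; exists y; last by rewrite -iE yE.
  by apply: k_inj; rewrite iE.
Qed.

End Exactness.

(** * Finite generation and noetherian modules *)

Section FiniteGeneration.

Variable R : pzRingType.
Implicit Types A B C K M N : lmodType R.

Lemma finitely_generated_free n : finitely_generated 'rV[R]_n.
Proof.
exists n, (fun i => delta_mx 0 i) => v; exists (fun i => v 0 i).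
exact: row_sum_delta.
Qed.

Lemma finitely_generated_image A B (f : {linear A -> B}) :
  surjective f -> finitely_generated A -> finitely_generated B.
Proof.
move=> f_surj [r [g gP]]; exists r, (f \o g) => b; have [a <-] := f_surj b.
have [c ->] := gP a; exists c; rewrite linear_sum.
by apply: eq_bigr => i _; rewrite linearZ.
Qed.

Lemma finitely_generatedP M :
  finitely_generated M <-> exists n (p : {linear 'rV[R]_n -> M}), surjective p.
Proof.
split=> [[n [g gP]]|[n [p p_surj]]]; last first.
  exact: finitely_generated_image p_surj (finitely_generated_free n).
have [|p pE] := @linear_bundle R 'rV[R]_n M (fun v => \sum_i v 0 i *: g i).
  move=> a u v; rewrite scaler_sumr -big_split; apply: eq_bigr => i _ /=.
  by rewrite !mxE scalerDl scalerA.
exists n, p => m; have [c ->] := gP m; exists (\row_i c i); rewrite pE.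
by apply: eq_bigr => i _; rewrite mxE.
Qed.

(** Generators of [B]: the images of those of [A], together with lifts of those of [C]. *)
Lemma finitely_generated_extension A B C
    (f : {linear A -> B}) (g : {linear B -> C}) :
  short_exact f g -> finitely_generated A -> finitely_generated C ->
  finitely_generated B.
Proof.
case=> _ g_surj fgP [r [x xP]] [r' [y yP]].
have [s sK] := surjective_section g_surj.
pose z i := match @split r r' i with inl j => f (x j) | inr k => s (y k) end.
exists (r + r')%N, z => b; have [d gb] := yP (g b).
have /fgP[a fa] : g (b - \sum_k d k *: s (y k)) = 0.
  rewrite linearB linear_sum gb /=; apply/eqP; rewrite subr_eq0; apply/eqP.
  by apply: eq_bigr => k _; rewrite linearZ /= sK.
have [c aE] := xP a.
exists (fun i => match @split r r' i with inl j => c j | inr k => d k end).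
rewrite big_split_ord /= -[LHS](subrK (\sum_k d k *: s (y k))) -fa aE.
rewrite linear_sum; congr (_ + _); apply: eq_bigr => i _.
  by rewrite /z -[lshift _ _]/(unsplit (inl i)) unsplitK linearZ.
by rewrite /z -[rshift _ _]/(unsplit (inr i)) unsplitK.
Qed.

(** The noetherian property in terms of generators, with submodules given as injective linear
    maps. *)
Definition all_sub_fg M : Prop :=
  forall N (i : {linear N -> M}), injective i -> finitely_generated N.

(** A submodule [N] of [B] is an extension of its image [I] in [C] by a submodule [K] of [A]. *)
Lemma all_sub_fg_extension A B C (f : {linear A -> B}) (g : {linear B -> C}) :
  short_exact f g -> all_sub_fg A -> all_sub_fg C -> all_sub_fg B.
Proof.
case=> f_inj _ fgP A_fg C_fg N i i_inj.
have [I [j [e [j_inj e_surj jeE]]]] := image_exists (g \o i : {linear N -> C}).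
have [K [k k_e]] := short_exact_kernel e_surj.
have [|h hE] := linear_factor (f := i \o k : {linear K -> B}) f_inj.
  move=> x; apply/fgP.
  by rewrite -[LHS](jeE (k x)) (short_exact_comp0 _ k_e) linear0.
apply: (finitely_generated_extension k_e _ (C_fg _ _ j_inj)).
apply: (A_fg _ h); apply: raddf_inj => x /= hx.
by have [k_inj _ _] := k_e; apply/k_inj/i_inj; rewrite -[LHS]hE hx !linear0.
Qed.

(** The preimage in [A] of a submodule [N] of [B], realized as a pullback, is finitely generated and
    maps onto [N]. *)
Lemma all_sub_fg_image A B (p : {linear A -> B}) :
  surjective p -> all_sub_fg A -> all_sub_fg B.
Proof.
move=> p_surj A_fg N i i_inj.
have [X [q [r [pqir X_onto X_inj]]]] := pullback_exists p i.
apply: (@finitely_generated_image X N r) => [n|].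
  by have [a pa] := p_surj (i n); have [x [_ rx]] := X_onto a n pa; exists x.
apply: (A_fg _ q); apply: raddf_inj => x /= qx; apply: X_inj => //.
by apply: i_inj; rewrite -pqir qx !linear0.
Qed.

(* A submodule that is not finitely generated contains a sequence x none of whose
   terms is in the span of its predecessors; these spans form a strictly
   ascending chain. *)
Lemma noetherian_all_sub_fg M : noetherian M -> all_sub_fg M.
Proof.
move=> M_noeth N i i_inj; apply: NNPP => N_nfg.
pose span (s : seq N) y := exists c : nat -> R, y = \sum_(k < size s) c k *: s`_k.
have /choice [pick pickP] : forall s : seq N, exists y, ~ span s y.
  move=> s; apply: NNPP => s_span; apply: N_nfg.
  exists (size s), (fun k : 'I_(size s) => s`_k) => y.
  apply: NNPP => y_span; apply: s_span; exists y => -[c yE].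
  by apply: y_span; exists c.
pose s n := iter n (fun t => rcons t (pick t)) [::].
pose x n := pick (s n).
have sE n : s n = mkseq x n by elim: n => // n IHn; rewrite mkseqS -IHn.
pose I n := classical_pred
  (fun v => exists c : nat -> R, v = i (\sum_(k < n) c k *: x k)).
have [n||n0 n0P] := M_noeth I.
- split=> [|a u v].
    apply/classical_predP; exists (fun=> 0); rewrite big1 ?linear0 // => k _.
    exact: scale0r.
  move=> /classical_predP[c ->] /classical_predP[d ->].
  apply/classical_predP; exists (fun k => a * c k + d k); rewrite -linearP.
  congr (i _); rewrite scaler_sumr -big_split; apply: eq_bigr => k _ /=.
  by rewrite scalerDl scalerA.
- move=> n v /classical_predP[c ->]; apply/classical_predP.
  exists (fun k => if (k < n)%N then c k else 0).
  rewrite big_ord_recr /= ltnn scale0r addr0; congr (i _).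
  by apply: eq_bigr => k _; rewrite ltn_ord.
have : i (x n0) \in I n0.+1.
  apply/classical_predP; exists (fun k => (k == n0)%:R).
  rewrite big_ord_recr /= eqxx scale1r big1 ?add0r // => k _.
  by rewrite ltn_eqF // scale0r.
rewrite n0P // => /classical_predP[c /i_inj xE].
apply: (pickP (s n0)); rewrite -/(x n0); exists c; rewrite xE sE size_mkseq.
by apply: eq_bigr => k _; rewrite nth_mkseq.
Qed.

(** Induction along [0 -> R^n -> R^(n+1) -> R -> 0], where [g] reads the first coordinate and [f]
    prepends a zero. *)
Lemma all_sub_fg_free n : left_noetherian R -> all_sub_fg 'rV[R]_n.
Proof.
move=> R_noeth; elim: n => [|n IHn].
  move=> N i i_inj; exists 0%N, (fun=> 0) => m; exists (fun=> 0).
  by rewrite big_ord0; apply: i_inj; rewrite [LHS]thinmx0 [RHS]thinmx0.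
have [|f fE] := @linear_bundle R 'rV[R]_n 'rV[R]_n.+1 (row_mx (0 : 'rV[R]_1)).
  move=> a u v.
  by rewrite (@scale_row_mx _ 1 1 n) (@add_row_mx _ 1 1 n) scaler0 addr0.
have [|g gE] := @linear_bundle R 'rV[R]_n.+1 R^o (fun v => v 0 0).
  by move=> a u v; rewrite !mxE.
apply: (@all_sub_fg_extension _ _ _ f g) IHn (noetherian_all_sub_fg R_noeth).
split=> [u v|a|v].
- by rewrite !fE => /(@eq_row_mx _ 1 1 n)[].
- by exists (const_mx a); rewrite gE mxE.
rewrite gE; split=> [v0|[u <-]]; last first.
  by rewrite fE mxE; case: splitP => // j _; rewrite mxE.
exists (@rsubmx _ 1 1 n v); apply/rowP=> j; rewrite fE mxE.
case: splitP => k jk; rewrite mxE; last by congr (v 0 _); apply: val_inj.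
by rewrite -[LHS]v0; congr (v 0 _); apply: val_inj; rewrite /= jk ord1.
Qed.

Lemma finitely_generated_sub M N (i : {linear N -> M}) :
  left_noetherian R -> injective i -> finitely_generated M ->
  finitely_generated N.
Proof.
move=> R_noeth i_inj /finitely_generatedP[n [p p_surj]].
exact: (all_sub_fg_image p_surj (@all_sub_fg_free n R_noeth)) i_inj.
Qed.

End FiniteGeneration.

(** * Torsion modules over an Ore set *)

Section Torsion.

Variables (R : pzRingType) (S : {pred R}) (S_ore : regular_ore_set S).
Implicit Types A B C M N : lmodType R.

Lemma torsion_sub M N (i : {linear N -> M}) :
  injective i -> torsion S M -> torsion S N.
Proof.
move=> i_inj M_tors x; have [s sS six] := M_tors (i x); exists s => //.
by apply: i_inj; rewrite linearZ /= six linear0.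
Qed.

Lemma torsion_extension A B C (f : {linear A -> B}) (g : {linear B -> C}) :
  short_exact f g -> torsion S A -> torsion S C -> torsion S B.
Proof.
have [[_ SM] _ _ _] := S_ore.
case=> _ _ fgP A_tors C_tors x; have [s sS sgx] := C_tors (g x).
have /fgP[a fa] : g (s *: x) = 0 by rewrite linearZ.
have [t tS ta] := A_tors a; exists (t * s); first exact: SM.
by rewrite -scalerA -fa -linearZ /= ta linear0.
Qed.

(** Torsion of an image of a free module can be tested on generators: by the left Ore condition,
    torsion elements are stable under sums and scaling. *)
Lemma torsion_free_image M n (p : {linear 'rV[R]_n -> M}) :
  surjective p ->
  (forall j, exists2 s, s \in S & s *: p (delta_mx 0 j) = 0) -> torsion S M.
Proof.
have [[S1 SM] _ _ S_left] := S_ore.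
move=> p_surj gen_tors m; have [v <-] := p_surj m.
rewrite [v]row_sum_delta linear_sum.
apply: (big_ind (fun x : M => exists2 s, s \in S & s *: x = 0)).
- by exists 1; rewrite ?scaler0.
(* The common multiple [r * t = s' * s] lies in [S] and kills both [x] and [y]. *)
- move=> x y [s sS sx] [t tS ty]; have [r [s' [s'S rt]]] := S_left t s tS.
  exists (s' * s); first exact: SM.
  by rewrite scalerDr -{1}scalerA sx -rt -scalerA ty !scaler0 addr0.
move=> j _; have [s sS sx] := gen_tors j.
(* From [r * s = s' * v 0 j], the element [s'] moves past the coefficient and leaves [s] next to the
   generator. *)
have [r [s' [s'S rs]]] := S_left s (v 0 j) sS; exists s' => //.
by rewrite linearZ /= scalerA -rs -scalerA sx scaler0.
Qed.

End Torsion.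

(** * Kernels, pullbacks and presentations among finitely generated torsion modules *)

Section Category.

Variables (R : pzRingType) (S : {pred R}).
Hypotheses (R_noeth : left_noetherian R) (S_ore : regular_ore_set S).
Implicit Types K L M N P Q X Z : fgtors S.

(** Stated as an equality of modules, so that maps already built on [N] can be transported to an
    object of the category. *)
Lemma fgtors_sub (M : fgtors S) (N : lmodType R) (i : {linear N -> M}) :
  injective i -> exists N' : fgtors S, fgtors_mod N' = N.
Proof.
move=> i_inj.
have N_fg := finitely_generated_sub R_noeth i_inj (fgtors_fg M).
by exists (FGTors N_fg (torsion_sub i_inj (@fgtors_tors _ _ M))).
Qed.

Lemma fgtors_kernel M P (g : {linear M -> P}) : surjective g ->
  exists K (k : {linear K -> M}), short_exact k g.
Proof.
move=> /short_exact_kernel[A [k k_g]]; have [k_inj _ _] := k_g.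
by have [K KE] := fgtors_sub k_inj; case: _ / KE k k_g {k_inj} => k; exists K, k.
Qed.

(** The pullback is a submodule of [M * N], which is in the category as an extension of [N] by
    [M]. *)
Lemma fgtors_pullback M N P (f : {linear M -> P}) (g : {linear N -> P}) :
  exists (X : fgtors S) (p : {linear X -> M}) (q : {linear X -> N}),
    is_pullback f g p q.
Proof.
have [X [p [q pb]]] := pullback_exists f g; have [_ _ pq_inj] := pb.
have [|i iE] := @linear_bundle R X (M * N)%type (fun x => (p x, q x)).
  by move=> a x y; rewrite !linearP.
have i_inj : injective i.
  by apply: raddf_inj => x /=; rewrite iE => -[px qx]; apply: pq_inj.
have [|l lE] := @linear_bundle R M (M * N)%type (fun x => (x, 0)).
  by move=> a x y; congr (_, _); rewrite /= scaler0 addr0.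
have l_snd : short_exact l (snd : {linear (M * N)%type -> N}).
  split=> [x y|y|[x y] /=]; first by rewrite !lE => -[].
    by exists (0, y).
  by split=> [->|[z]]; [exists x | rewrite lE => -[]].
pose MN := FGTors (finitely_generated_extension l_snd (fgtors_fg M) (fgtors_fg N))
  (torsion_extension S_ore l_snd (@fgtors_tors _ _ M) (@fgtors_tors _ _ N)).
have [X' XE] := @fgtors_sub MN X i i_inj.
by case: _ / XE p q pb {pq_inj i iE i_inj} => p q; exists X', p, q.
Qed.

Lemma in_P_zero : exists Z : fgtors S, in_P Z /\ forall z : Z, z = 0.
Proof.
have Z_fg := @finitely_generated_free R 0.
have [[S1 _] _ _ _] := S_ore.
have Z_tors : torsion S 'rV[R]_0 by move=> z; exists 1; rewrite // [LHS]thinmx0.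
exists (FGTors Z_fg Z_tors); split=> [|z]; last exact: thinmx0.
apply/proj_dim_le1P; exists 'rV[R]_0, 'rV[R]_0, idfun, \0.
split; [exact: projective_free..|split=> // z].
  by exists 0; rewrite [RHS]thinmx0.
by split=> [_|_]; [exists z | rewrite [LHS]thinmx0].
Qed.

(* P is the direct sum of the cyclic modules R / R s_j, where s_j in S kills the
   j-th generator of M. *)
Lemma in_P_cover M :
  exists P (g : {linear P -> M}), in_P P /\ surjective g.
Proof.
have [_ S_reg _ S_left] := S_ore.
have /finitely_generatedP[n [p p_surj]] := fgtors_fg M.
have /choice[s sP] :
    forall j : 'I_n, exists s, s \in S /\ s *: p (delta_mx 0 j) = 0.
  by move=> j; have [s] := @fgtors_tors _ _ M (p (delta_mx 0 j)); exists s.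
(* Right multiplication by the diagonal matrix of the [s j]: left linear, and injective because each
   [s j] is regular. Its cokernel [Q] is the cover. *)
have [|d dE] :=
    @linear_bundle R 'rV[R]_n 'rV[R]_n (fun v => \row_j (v 0 j * s j)).
  by move=> a u v; apply/rowP=> j; rewrite !mxE mulrDl mulrA.
have d_inj : injective d.
  move=> u v; rewrite !dE => /rowP duv; apply/rowP => j.
  by have := duv j; rewrite !mxE; apply: (S_reg _ (sP j).1).2.
have [|Q [q [q_surj qP]]] :=
    @quotient_exists R 'rV[R]_n (classical_pred (fun v => exists u, d u = v)).
  split=> [|a v w]; first by apply/classical_predP; exists 0; rewrite linear0.
  move=> /classical_predP[x <-] /classical_predP[y <-].
  by apply/classical_predP; exists (a *: x + y); rewrite linearP.
have d_q : short_exact d q.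
  by split=> // v; rewrite qP; split=> /classical_predP.
have Q_fg := finitely_generated_image q_surj (@finitely_generated_free R n).
have Q_tors : torsion S Q.
  apply: (torsion_free_image S_ore q_surj) => j.
  exists (s j); first exact: (sP j).1.
  rewrite -linearZ; apply/qP/classical_predP; exists (delta_mx 0 j).
  rewrite dE; apply/rowP=> k; rewrite !mxE eqxx /=.
  by rewrite mulr_natl mulr_natr; case: (eqVneq k j) => [->|_].
(* [t] need not be linear, but [p \o t] is: [p] kills the image of [d], so it descends to [Q]. *)
have [t tK] := surjective_section q_surj.
have pd u : p (d u) = 0.
  rewrite dE [\row_j _]row_sum_delta linear_sum big1 // => j _.
  by rewrite linearZ /= mxE -scalerA (sP j).2 scaler0.
have pq0 v : q v = 0 -> p v = 0.
  by move=> /qP/classical_predP[u <-]; exact: pd.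
have ptq v : p (t (q v)) = p v.
  by apply/eqP; rewrite -subr_eq0 -linearB pq0 // linearB /= tK subrr.
have [|g gE] := @linear_bundle R Q M (p \o t).
  by move=> a x y /=; rewrite -{1}[x]tK -{1}[y]tK -linearP ptq linearP.
exists (FGTors Q_fg Q_tors), g; split=> [|m].
  apply/proj_dim_le1P; exists 'rV[R]_n, 'rV[R]_n, d, q.
  by split=> //; apply: projective_free.
by have [v <-] := p_surj m; exists (q v); rewrite gE /= ptq.
Qed.

Lemma presentation_exists M :
  exists N P (f : {linear N -> P}) (g : {linear P -> M}),
    in_P P /\ short_exact f g.
Proof.
have [P [g [PP g_surj]]] := in_P_cover M.
by have [N [f f_g]] := fgtors_kernel g_surj; exists N, P, f, g.
Qed.

(** * Construction, splicing and cutting of left resolutions *)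

Lemma left_resolution0 M : inhabited (left_resolution 0 M).
Proof.
(* Both branches are the identity; the case split is there because [target] reduces only on a
   constructor. *)
pose d i : {linear M -> target M (fun=> M) i} :=
  if i is 0%N then idfun : {linear M -> M} else idfun : {linear M -> M}.
have seq : exact_sequence 0 M (fun=> M).
  by exists d => // m; exists m.
by constructor; exists (fun=> M).
Qed.

(** Splicing: the resolution of [N] is shifted by one place and joined to [P] by the composite of
    its augmentation [d 0] with [f]. *)
Lemma left_resolution_cons n M N P (f : {linear N -> P}) (g : {linear P -> M}) :
  in_P P -> short_exact f g -> left_resolution n N ->
  inhabited (left_resolution n.+1 M).
Proof.
move=> PP f_g [Y [d d_inj d_exact d_surj] Y_P]; have [f_inj g_surj fgP] := f_g.
pose X i := if i is j.+1 then Y j else P.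
pose e i : {linear X i -> target M (fun i => X i) i} :=
  match i with
  | 0%N => g | 1%N => (f \o d 0%N : {linear Y 0%N -> P}) | j.+2 => d j.+1 end.
constructor; apply: (@LeftResolution _ _ n.+1 M X) => [|[|i]]; last exact: Y_P.
  exists e => //.
    case: n d_inj {d_exact Y_P} => [|n] d_inj //=.
    by move=> x y /f_inj/d_inj.
  move=> [|[|i]] i_n x; last exact: (d_exact i.+1 i_n x).
    split=> [/fgP[y <-]|[y <-]] /=; last by rewrite (short_exact_comp0 _ f_g).
    by have [z <-] := d_surj y; exists z.
  rewrite -(d_exact 0%N) //=; split=> [fd0|->]; last exact: linear0.
  by apply: f_inj; rewrite fd0 linear0.
by [].
Qed.

(** Cutting at the kernel [N] of [X 0 -> M]: exactness makes [X 1 -> X 0] factor through [N], onto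
    it. *)
Lemma left_resolution_uncons n M (X : left_resolution n.+1 M) :
  in_P (X 0%N) /\
  exists N (f : {linear N -> X 0%N}) (g : {linear X 0%N -> M})
    (Y : left_resolution n N),
    short_exact f g /\ forall i, Y i = X i.+1.
Proof.
case: X => X [d d_inj d_exact d_surj] X_P /=; split; first exact: X_P.
have [N [f f_g]] :=
  fgtors_kernel (d_surj : surjective (d 0%N : {linear X 0%N -> M})).
have [f_inj _ fgP] := f_g.
have [|e eE] := linear_factor (f := d 1%N : {linear X 1%N -> X 0%N}) f_inj.
  by move=> x; apply/fgP/(d_exact 0%N isT); exists x.
pose Y i := X i.+1.
pose c i : {linear Y i -> target N (fun i => Y i) i} :=
  if i is j.+1 then d j.+2 else e.
have seq : exact_sequence n N (fun i => Y i).
  exists c.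
  - case: n d_inj {d_exact X_P} => [|n] //= d_inj x y exy.
    by apply: d_inj; rewrite /= -!eE exy.
  - move=> [|i] i_n x; last exact: (d_exact i.+2 i_n x).
    rewrite -(d_exact 1%N) //= -eE; split=> [->|fe0]; first exact: linear0.
    by apply: f_inj; rewrite fe0 linear0.
  move=> y.
  have /(d_exact 0%N isT)[x dx] : d 0%N (f y) = 0 by apply/fgP; exists y.
  by exists x; apply: f_inj; rewrite eE.
by exists N, f, (d 0%N), (LeftResolution seq (fun i i_n => X_P i.+1 i_n)).
Qed.

Lemma left_resolution_exists n M : inhabited (left_resolution n M).
Proof.
elim: n M => [|n IHn] M; first exact: left_resolution0.
have [N [P [f [g [PP f_g]]]]] := presentation_exists M.
by have [Y] := IHn N; apply: left_resolution_cons PP f_g Y.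
Qed.

(** * Fitting invariants and their shifts *)

Section Fitting.

Variables (Omega : Type) (one : Omega) (mul : Monoid.com_law one).
Implicit Type F G : fgtors S -> Omega.

(* The monoid laws for [mul] itself; those of the library leave behind coercions
   that later rewriting does not see through. *)
Let mulA : associative mul. Proof. by move=> *; rewrite mulmA. Qed.
Let mulC : commutative mul. Proof. by move=> *; rewrite mulmC. Qed.
Let mul1 : left_id one mul. Proof. by move=> *; rewrite mul1m. Qed.
Let mulx1 : right_id one mul. Proof. by move=> *; rewrite mulm1. Qed.
Let mulACA : interchange mul mul. Proof. by move=> *; rewrite mulmACA. Qed.
Let mulCA : left_commutative mul. Proof. by move=> *; rewrite mulmCA. Qed.

Lemma mul_inv x : is_unit mul x -> mul x (inv mul x) = one.
Proof. exact: epsilon_spec. Qed.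

Lemma mul_invK x y : is_unit mul x -> mul x (mul (inv mul x) y) = y.
Proof. by move=> x_unit; rewrite mulA mul_inv // mul1. Qed.

Lemma inv_unit x : is_unit mul x -> is_unit mul (inv mul x).
Proof. by move=> /mul_inv xV; exists x; rewrite mulC. Qed.

Lemma unit_mulI x y z : is_unit mul x -> mul x y = mul x z -> y = z.
Proof.
case=> v xv /(congr1 (mul v)).
by rewrite !mulA [mul v x]mulC xv !mul1.
Qed.

Lemma inv_inv x : is_unit mul x -> inv mul (inv mul x) = x.
Proof.
move=> x_unit; apply: (unit_mulI (inv_unit x_unit)).
by rewrite mul_inv; [rewrite mulC mul_inv | apply: inv_unit].
Qed.

Lemma inv_mul x y : is_unit mul x -> is_unit mul y ->
  inv mul (mul x y) = mul (inv mul x) (inv mul y).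
Proof.
move=> xU yU; have xyxy : mul (mul x y) (mul (inv mul x) (inv mul y)) = one.
  by rewrite mulACA !mul_inv ?mul1.
have xyU : is_unit mul (mul x y) by eexists; apply: xyxy.
by apply: (unit_mulI xyU); rewrite xyxy mul_inv.
Qed.

(** The sequence [0 -> Z -> Z -> Z -> 0] makes [F Z] an idempotent unit. *)
Lemma fitting_zero F Z : fitting_invariant mul F -> in_P Z ->
  (forall z : Z, z = 0) -> F Z = one.
Proof.
move=> [F_unit F_ses] ZP Z0; apply: (unit_mulI (F_unit _ ZP)).
rewrite mulx1 -(F_ses Z Z Z idfun \0 ZP) //.
by split=> // [z|x]; [exists 0; rewrite [RHS]Z0|split=> [_|_ //]; exists x].
Qed.

(** An isomorphism is an exact sequence [0 -> N -> M -> Z -> 0] with [Z] zero. *)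
Lemma fitting_iso F M N (f : {linear N -> M}) :
  fitting_invariant mul F -> injective f -> surjective f -> F M = F N.
Proof.
move=> F_fit f_inj f_surj; have [Z [ZP Z0]] := in_P_zero.
rewrite -[RHS]mul1 -[X in mul X _](fitting_zero F_fit ZP Z0).
apply: (F_fit.2 _ _ _ f (\0 : {linear M -> Z})) => //.
by split=> // z; exists 0; rewrite [RHS]Z0.
Qed.

Lemma fitting_presentation_unique F M N P N' P'
    (f : {linear N -> P}) (g : {linear P -> M})
    (f' : {linear N' -> P'}) (g' : {linear P' -> M}) :
  fitting_invariant mul F -> in_P P -> in_P P' ->
  short_exact f g -> short_exact f' g' ->
  mul (inv mul (F P)) (F N) = mul (inv mul (F P')) (F N').
Proof.
move=> [F_unit F_ses] PP PP' f_g f'_g'.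
have [X [p [q pb]]] := fgtors_pullback g g'.
have [m m_p] := pullback_short_exact pb f'_g'.
have [m' m'_q] := pullback_short_exact (is_pullback_sym pb) f_g.
(* After multiplication by [F P] and [F P'] both sides equal [F X]. *)
apply: (unit_mulI (F_unit _ PP)); apply: (unit_mulI (F_unit _ PP')).
rewrite [RHS]mulCA !mul_invK; [|exact: F_unit..].
by rewrite -(F_ses _ _ _ _ _ PP' m'_q) -(F_ses _ _ _ _ _ PP m_p).
Qed.

(** [G] is F^[1]. Its value is prescribed on all presentations at once, so the existence of [G]
    includes independence of the choice. *)
Definition shift_of F G : Prop :=
  forall M N P (f : {linear N -> P}) (g : {linear P -> M}),
    in_P P -> short_exact f g -> G M = mul (inv mul (F P)) (F N).

Lemma shift_exists F : fitting_invariant mul F -> exists G, shift_of F G.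
Proof.
move=> F_fit.
have /choice[G GP] : forall M, exists w, forall N P (f : {linear N -> P})
    (g : {linear P -> M}), in_P P -> short_exact f g ->
    w = mul (inv mul (F P)) (F N).
  move=> M; have [N [P [f [g [PP f_g]]]]] := presentation_exists M.
  exists (mul (inv mul (F P)) (F N)) => N' P' f' g' PP' f'_g'.
  exact: fitting_presentation_unique F_fit PP PP' f_g f'_g'.
by exists G.
Qed.

(** Computed on the presentation [0 -> 0 -> P -> P -> 0]. *)
Lemma shift_in_P F G P :
  fitting_invariant mul F -> shift_of F G -> in_P P -> G P = inv mul (F P).
Proof.
move=> F_fit GP PP; have [Z [ZP Z0]] := in_P_zero.
rewrite (GP P Z P \0 idfun) //; first by rewrite (fitting_zero F_fit ZP Z0) mulx1.
split=> [x y _|y|x]; first by rewrite [x]Z0 [y]Z0.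
  by exists y.
by split=> /= [->|[y <-]] //; exists 0.
Qed.

Lemma shift_fitting F G :
  fitting_invariant mul F -> shift_of F G -> fitting_invariant mul G.
Proof.
move=> F_fit GP; have [F_unit F_ses] := F_fit; split=> [P PP|L M P f g PP f_g].
  by rewrite (shift_in_P F_fit GP PP); apply/inv_unit/F_unit.
have [N [Q [n [q [QP n_q]]]]] := presentation_exists M.
have [f_inj g_surj fgP] := f_g; have [n_inj q_surj nqP] := n_q.
have gq_surj : surjective (g \o q).
  by move=> x; have [y <-] := g_surj x; have [z <-] := q_surj y; exists z.
have [K [k k_gq]] := @fgtors_kernel Q P (g \o q) gq_surj.
have KP : in_P K := proj_dim_le1_kernel k_gq QP PP.
have [k_inj _ kP] := k_gq.
have [|e eE] := linear_factor (f := q \o k : {linear K -> M}) f_inj.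
  by move=> x; apply/fgP/(short_exact_comp0 _ k_gq).
have [|i iE] := linear_factor (f := n) k_inj.
  by move=> x; apply/kP; rewrite /= (short_exact_comp0 _ n_q) linear0.
have i_e : short_exact i e.
  split=> [x y ixy|l|x]; first by apply: n_inj; rewrite -!iE ixy.
    have [y yE] := q_surj (f l).
    have /kP[x kx] : (g \o q) y = 0 by rewrite /= yE (short_exact_comp0 _ f_g).
    by exists x; apply: f_inj; rewrite eE /= kx.
  have -> : e x = 0 <-> q (k x) = 0.
    split=> [ex0|qkx]; first by rewrite -[LHS]eE ex0 linear0.
    by apply: f_inj; rewrite eE linear0.
  rewrite nqP; split=> -[y yE]; exists y; last by rewrite -iE yE.
  by apply: k_inj; rewrite iE.
(* [G M] is computed with [Q] and [G L] with [K], both with the same [N]; [F Q = F P * F K] then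
   splits off [G P], the inverse of [F P]. *)
rewrite (GP _ _ _ _ _ QP n_q) (GP _ _ _ _ _ KP i_e) (shift_in_P F_fit GP PP).
rewrite (F_ses _ _ _ _ _ PP k_gq) inv_mul ?mulA //; exact: F_unit.
Qed.

(** [X 0] is P_(n+1), the last factor of the product. The other P_i keep their index, hence their
    sign, since [n.+1 - i] counts from [X 0] and [n - i] from [X 1]. *)
Lemma resolution_value_uncons F n M (X : left_resolution n.+1 M) N
    (Y : left_resolution n N) :
  (forall i, Y i = X i.+1) ->
  resolution_value mul F X =
    mul (pow_sign mul (F (X 0%N)) n.+1) (resolution_value mul F Y).
Proof.
move=> YX.
rewrite /resolution_value big_nat_recr //= /lr_Pterm /lr_Nterm subnn YX.
rewrite [mul (\big[_/_]_(_ <= _ < _) _) _]mulC -mulA; congr (mul _ (mul _ _)).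
by apply: eq_big_nat => i /andP[_ i_n]; rewrite YX subSn.
Qed.

Lemma pow_signS x n : is_unit mul x ->
  inv mul (pow_sign mul x n) = pow_sign mul x n.+1.
Proof.
by move=> x_unit; rewrite /pow_sign /=; case: odd => //=; apply: inv_inv.
Qed.

(** The third clause carries the induction: it turns the inverse of [G (X 0)] into the signed power
    of [F (X 0)] for [n.+1]. *)
Lemma resolution_value_fitting F n : fitting_invariant mul F ->
  exists G,
  [/\ forall M (X : left_resolution n M), G M = resolution_value mul F X,
    fitting_invariant mul G
  & forall P, in_P P -> G P = pow_sign mul (F P) n].
Proof.
move=> F_fit; have [F_unit _] := F_fit.
elim: n => [|n [G [G_val G_fit G_P]]].
  (* For [n = 0] the product is empty and [d 0] is an isomorphism from N onto [M]. *)
  exists F; split=> // M [X [d d_inj d_exact d_surj] X_P].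
  rewrite /resolution_value big_geq // mul1.
  exact: (fitting_iso (f := d 0%N : {linear X 0%N -> M}) F_fit).
have [H HG] := shift_exists G_fit.
have H_P P : in_P P -> H P = pow_sign mul (F P) n.+1.
  move=> PP; rewrite (shift_in_P G_fit HG PP) G_P // pow_signS //.
  exact: F_unit.
exists H; split=> //; last exact: shift_fitting HG.
move=> M X; have [X0P [N [f [g [Y [f_g YX]]]]]] := left_resolution_uncons X.
rewrite (resolution_value_uncons F YX) -G_val (HG _ _ _ _ _ X0P f_g) G_P //.
by rewrite pow_signS //; apply: F_unit.
Qed.

End Fitting.

End Category.

Theorem theorem2p6 (R : pzRingType) (S : {pred R})
  (R_left_noetherian : left_noetherian R)
  (R_right_noetherian : right_noetherian R)
  (S_ore : regular_ore_set S)
  (Omega : Type) (one : Omega) (mul : Monoid.com_law one)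
  (F : fgtors S -> Omega) (F_fitting : fitting_invariant mul F) (n : nat) :
  (forall M : fgtors S, inhabited (left_resolution n M)) /\
  (forall (M : fgtors S) (X Y : left_resolution n M),
     resolution_value mul F X = resolution_value mul F Y) /\
  (exists Fn : fgtors S -> Omega,
     (forall (M : fgtors S) (X : left_resolution n M),
        Fn M = resolution_value mul F X) /\
     fitting_invariant mul Fn).
Proof.
have [G [G_val G_fit _]] :=
  resolution_value_fitting R_left_noetherian S_ore n F_fitting.
split; first exact: left_resolution_exists.
by split=> [M X Y|]; [rewrite -!G_val | exists G].
Qed.
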